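(* Let $V_1,\dots,V_m$ be $\mathcal{C}$-modules and let $1\le i\le m$. Then $$Q_i(V_1\boxtimes\cdots\boxtimes V_m)\;\cong\;V_1\boxtimes\cdots\boxtimes V_{i-1}\boxtimes Q(V_i)\boxtimes V_{i+1}\boxtimes\cdots\boxtimes V_m$$ as $\mathcal{C}^m$-modules.
   Context: Throughout, $m$ is a positive integer and $k$ is a field of characteristic $0$. $\mathcal{C}=\mathrm{FI}$ is the category of finite sets and injections; $\mathcal{C}^m=\mathrm{FI}^m$ is its $m$-fold product, with objects $m$-tuples $\mathbf{S}=(S_1,\dots,S_m)$ of finite sets and morphisms $m$-tuples of injections. A $\mathcal{C}^m$-module is a covariant functor from $\mathcal{C}^m$ to $k$-vector spaces; these form the category $\mathcal{C}^m\text{-Mod}$. For an object $\mathbf{S}$, $M(\mathbf{S})$ is the $\mathcal{C}^m$-module sending $\mathbf{T}$ to the $k$-vector space with basis $\mathcal{C}^m(\mathbf{S},\mathbf{T})$. The external tensor product of $\mathcal{C}$-modules is $(V_1\boxtimes\cdots\boxtimes V_m)(S_1,\dots,S_m)=V_1(S_1)\otimes_k\cdots\otimes_k V_m(S_m)$, and similarly on morphisms. For a finite set $S$ let $\widehat S=S\sqcup\{*\}$, and let $\iota:\mathcal{C}\to\mathcal{C}$ be the functor with $\iota(S)=\widehat S$ and, for $\alpha:S\to T$, $\iota(\alpha):\widehat S\to\widehat T$ acting as $\alpha$ on $S$ and fixing $*$. For $1\le i\le m$ let $\iota_i:\mathcal{C}^m\to\mathcal{C}^m$ apply $\iota$ in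 the $i$-th component and the identity in the others. The $i$-th shift functor is $\Sigma_i:\mathcal{C}^m\text{-Mod}\to\mathcal{C}^m\text{-Mod}$, $V\mapsto V\circ\iota_i$. The $i$-th coinduction functor $Q_i:\mathcal{C}^m\text{-Mod}\to\mathcal{C}^m\text{-Mod}$ is given by $Q_i(V)(\mathbf{S})=\mathrm{Hom}_{\mathcal{C}^m}(\Sigma_iM(\mathbf{S}),V)$, where a morphism $\mathbf{r}:\mathbf{S}\to\mathbf{T}$ sends $\alpha\in Q_i(V)(\mathbf{S})$ to the homomorphism $\mathbf{g}\mapsto\alpha(\mathbf{g}\mathbf{r})$ in $Q_i(V)(\mathbf{T})$. For $m=1$, write $\Sigma=\Sigma_1$ and $Q=Q_1:\mathcal{C}\text{-Mod}\to\mathcal{C}\text{-Mod}$. *)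

(* Defs.v *)
From HB Require Import structures.
From mathcomp Require Import all_boot all_algebra.
From mathcomp Require Import boolp.
From mathcomp Require Import finmap.
From mathcomp Require Import monalg.
Set Implicit Arguments.
Unset Strict Implicit.
Unset Printing Implicit Defensive.

Import GRing.Theory.
Local Open Scope ring_scope.
Local Open Scope quotient_scope.

(* [{malg k[X]}] (finitely supported functions [X -> k]) is the vector space
   with basis [X], the basis vector of [x] being [<< x >>]. *)

Section Free.
Variables (k : fieldType) (X : choiceType).

Definition lin_ext (W : lmodType k) (h : X -> W) (u : {malg k[X]}) : W :=
  \sum_(x <- msupp u) u@_x *: h x.

Section LinExt.
Variables (W : lmodType k) (h : X -> W).

Lemma lin_extEw (d : {fset X}) (u : {malg k[X]}) :
  (msupp u `<=` d)%fset -> lin_ext h u = \sum_(x <- d) u@_x *: h x.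
Proof.
move=> le; rewrite /lin_ext [LHS](big_fset_incl _ le) //= => x _ xNu.
by rewrite mcoeff_outdom // scale0r.
Qed.

Lemma lin_ext_is_linear : linear (lin_ext h).
Proof.
move=> a u v.
pose d := (msupp u `|` msupp v `|` msupp (a *: u + v)%R)%fset.
rewrite !(@lin_extEw d); last first.
- exact: fsubsetUr.
- by rewrite /d -fsetUA fsubsetUl.
- by rewrite /d (fsetUC (msupp u)) -fsetUA fsubsetUl.
rewrite scaler_sumr -big_split /=; apply: eq_bigr => x _.
by rewrite mcoeffD mcoeffZ scalerDl scalerA.
Qed.

HB.instance Definition _ := GRing.isLinear.Build k {malg k[X]} W _
  (lin_ext h) lin_ext_is_linear.

Lemma lin_extU (x : X) : lin_ext h << x >> = h x.
Proof.
rewrite (@lin_extEw [fset x]%fset) ?msuppU_le //.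
by rewrite big_seq_fset1 mcoeffUU scale1r.
Qed.

Lemma lin_ext_uniq (f : {linear {malg k[X]} -> W}) :
  (forall x, f << x >> = h x) -> f =1 lin_ext h.
Proof.
move=> fU u; rewrite [in LHS](monalgE u) linear_sum /lin_ext.
apply: eq_bigr => x _; rewrite -fU -linearZ /=; congr (f _).
by apply/malgP => y; rewrite mcoeffZ !mcoeffU mulrnAr mulr1.
Qed.
End LinExt.

End Free.

Lemma free_ext (k : fieldType) (X : choiceType) (W : lmodType k)
    (f g : {linear {malg k[X]} -> W}) :
  (forall x, f << x >> = g << x >>) -> f =1 g.
Proof. by move=> fg u; rewrite (lin_ext_uniq fg) -(lin_ext_uniq (fun=> erefl)). Qed.

Definition lin_map (k : fieldType) (X Y : choiceType) (f : X -> Y) :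
    {malg k[X]} -> {malg k[Y]} := lin_ext (fun x => << f x >>).

HB.instance Definition _ (k : fieldType) (X Y : choiceType) (f : X -> Y) :=
  GRing.Linear.copy (@lin_map k X Y f) (lin_ext (fun x => << f x >>)).

Lemma lin_mapU (k : fieldType) (X Y : choiceType) (f : X -> Y) x :
  lin_map f << x >> = << f x >> :> {malg k[Y]}.
Proof. exact: lin_extU. Qed.

Lemma linear_ext (k : fieldType) (U W : lmodType k) (f g : {linear U -> W}) :
  f =1 g -> f = g.
Proof.
case: f g => f [[fA] [fB]] [g [[gA] [gB]]] /= /funext fg; subst g.
by congr GRing.Linear.Pack; congr GRing.Linear.Class; congr (_ _);
  apply: Prop_irrelevance.
Qed.

(* [dfwith v x] is [v] with its [i]-th entry replaced by [x : W i]. *)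
Definition multilinear (k : fieldType) (I : finType) (W : I -> lmodType k)
    (U : lmodType k) (f : (forall i, W i) -> U) : Prop :=
  forall (v : forall i, W i) (i : I), linear (fun x : W i => f (dfwith v x)).

Section Tensor.
Variables (k : fieldType) (I : finType) (W : I -> lmodType k).

Notation tfree := {malg k[{classic (forall i, W i)}]}.

Definition tgen (v : forall i, W i) : tfree :=
  << (v : {classic (forall i, W i)}) >>.

(* The span of the multilinearity relations. *)
Inductive tnull : tfree -> Prop :=
| tnull0 : tnull 0
| tnull_lin a r s : tnull r -> tnull s -> tnull (a *: r + s)
| tnull_rel v i a (x y : W i) :
    tnull (tgen (dfwith v (a *: x + y)) -
           (a *: tgen (dfwith v x) + tgen (dfwith v y))).

Definition tnullb : {pred tfree} := fun r => `[< tnull r >].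

Lemma tnullb_submod : submod_closed tnullb.
Proof.
split=> [|a r s /asboolP r0 /asboolP s0]; apply/asboolP.
  exact: tnull0.
exact: tnull_lin.
Qed.

HB.instance Definition _ :=
  GRing.isSubmodClosed.Build k tfree tnullb tnullb_submod.

Definition tensor : Type := Quotient.quot (tnullb : zmodClosed tfree).
HB.instance Definition _ := GRing.Zmodule.on tensor.

Definition tpi (r : tfree) : tensor := \pi r.
Definition trepr (t : tensor) : tfree := repr t.

Lemma treprK t : tpi (trepr t) = t.
Proof. exact: reprK. Qed.

Lemma tpi_eqP r s : tpi r = tpi s <-> tnull (r - s).
Proof.
split; first by move/eqP; rewrite -Quotient.idealrBE => /asboolP.
by move=> rs; apply/eqP; rewrite -Quotient.idealrBE; apply/asboolP.
Qed.

Lemma tpiD r s : tpi (r + s) = tpi r + tpi s.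
Proof. by rewrite /tpi Quotient.pi_add. Qed.

Definition tscale (a : k) (t : tensor) : tensor := tpi (a *: trepr t).

Lemma tpiZ a r : tpi (a *: r) = tscale a (tpi r).
Proof.
apply/tpi_eqP; rewrite -scalerBr -[_ *: _]addr0.
by apply: tnull_lin tnull0; apply/tpi_eqP; rewrite treprK.
Qed.

Fact tscaleA a b t : tscale a (tscale b t) = tscale (a * b) t.
Proof. by rewrite -(treprK t) -!tpiZ scalerA. Qed.
Fact tscale1 : left_id 1 tscale.
Proof. by move=> t; rewrite -(treprK t) -tpiZ scale1r. Qed.
Fact tscaleDr : right_distributive tscale +%R.
Proof.
by move=> a s t; rewrite -(treprK s) -(treprK t) -tpiD -!tpiZ -tpiD scalerDr.
Qed.
Fact tscaleDl t : {morph tscale^~ t : a b / a + b}.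
Proof. by move=> a b /=; rewrite -(treprK t) -!tpiZ -tpiD scalerDl. Qed.

HB.instance Definition _ :=
  GRing.Zmodule_isLmodule.Build k tensor tscaleA tscale1 tscaleDr tscaleDl.

Lemma tpi_is_linear : linear tpi.
Proof. by move=> a r s; rewrite tpiD tpiZ. Qed.
HB.instance Definition _ := GRing.isLinear.Build k tfree tensor _ tpi
  tpi_is_linear.

Definition pure (v : forall i, W i) : tensor := tpi (tgen v).

Lemma pure_multilinear : multilinear pure.
Proof.
move=> v i a x y; rewrite /pure -linearP.
by apply/tpi_eqP; apply: tnull_rel.
Qed.

Lemma tensor_ext (U : lmodType k) (f g : {linear tensor -> U}) :
  (forall v, f (pure v) = g (pure v)) -> f =1 g.
Proof.
move=> fg t; rewrite -(treprK t).
exact: (@free_ext k _ U (f \o tpi) (g \o tpi) fg (trepr t)).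
Qed.

(* The linear map induced by [f], for [f] multilinear. *)
Definition tensor_lift (U : lmodType k) (f : (forall i, W i) -> U)
    (t : tensor) : U :=
  lin_ext (f : {classic (forall i, W i)} -> U) (trepr t).

Section Lift.
Variables (U : lmodType k) (f : (forall i, W i) -> U).
Hypothesis f_ml : multilinear f.

Lemma tensor_lift_pi r :
  tensor_lift f (tpi r) = lin_ext (f : {classic (forall i, W i)} -> U) r.
Proof.
apply/eqP; rewrite /tensor_lift -subr_eq0 -linearB; apply/eqP.
have : tnull (trepr (tpi r) - r) by apply/tpi_eqP; rewrite treprK.
elim=> [|a s t _ s0 _ t0|v i a x y]; first exact: linear0.
  by rewrite linearP /= s0 t0 scaler0 addr0.
by rewrite linearB linearP /= !lin_extU f_ml subrr.
Qed.

Lemma tensor_lift_is_linear : linear (tensor_lift f).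
Proof.
move=> a s t; rewrite -(treprK s) -(treprK t) -linearP !tensor_lift_pi.
exact: linearP.
Qed.

Lemma tensor_lift_pure v : tensor_lift f (pure v) = f v.
Proof. by rewrite tensor_lift_pi lin_extU. Qed.

Lemma tensor_universal :
  exists2 F : {linear tensor -> U}, (forall v, F (pure v) = f v) &
    forall G : {linear tensor -> U}, (forall v, G (pure v) = f v) -> G =1 F.
Proof.
pose F : {linear tensor -> U} := HB.pack (tensor_lift f)
  (GRing.isLinear.Build k tensor U _ (tensor_lift f) tensor_lift_is_linear).
exists F => [v|G Gf]; first exact: tensor_lift_pure.
by apply: tensor_ext => v; rewrite Gf /= tensor_lift_pure.
Qed.
End Lift.

End Tensor.

Section TensorMap.
Variables (k : fieldType) (I : finType).

Definition tensor_map (W W' : I -> lmodType k)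
    (f : forall i, {linear W i -> W' i}) : tensor W -> tensor W' :=
  tensor_lift (fun v => pure (fun i => f i (v i))).

Section Theory.
Variables (W W' : I -> lmodType k) (f : forall i, {linear W i -> W' i}).

Lemma tensor_map_multilinear : multilinear (fun v => pure (fun i => f i (v i))).
Proof.
move=> v i a x y.
have E z : (fun j => f j (dfwith v z j)) = dfwith (fun j => f j (v j)) (f i z).
  by apply: functional_extensionality_dep => j; case: dfwithP => [|l il];
     rewrite ?dfwith_in ?dfwith_out.
by rewrite !E linearP pure_multilinear.
Qed.

HB.instance Definition _ := GRing.isLinear.Build k (tensor W) (tensor W') _
  (tensor_map f) (tensor_lift_is_linear tensor_map_multilinear).

Lemma tensor_map_pure v : tensor_map f (pure v) = pure (fun i => f i (v i)).
Proof. exact: (tensor_lift_pure tensor_map_multilinear). Qed.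
End Theory.

Lemma tensor_map_id (W : I -> lmodType k) (f : forall i, {linear W i -> W i}) :
  (forall i x, f i x = x) -> tensor_map f =1 id.
Proof.
move=> f1; apply: (@tensor_ext _ _ _ _ (tensor_map f) idfun) => v /=.
rewrite tensor_map_pure.
by congr pure; apply: functional_extensionality_dep => i; exact: f1.
Qed.

Lemma tensor_map_comp (W W' W'' : I -> lmodType k)
    (h : forall i, {linear W i -> W'' i})
    (g : forall i, {linear W' i -> W'' i})
    (f : forall i, {linear W i -> W' i}) :
  (forall i x, h i x = g i (f i x)) ->
  forall t, tensor_map h t = tensor_map g (tensor_map f t).
Proof.
move=> hE; apply: (@tensor_ext _ _ _ _ (tensor_map h)
  (tensor_map g \o tensor_map f)) => v /=.
rewrite !tensor_map_pure.
by congr pure; apply: functional_extensionality_dep => i; exact: hE.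
Qed.

End TensorMap.

Record category := Category {
  ob :> Type;
  hom : ob -> ob -> choiceType;
  idm : forall a, hom a a;
  comp : forall a b c, hom b c -> hom a b -> hom a c;
  comp1m : forall a b (f : hom a b), comp (idm b) f = f;
  compm1 : forall a b (f : hom a b), comp f (idm a) = f;
  compmA : forall a b c d (h : hom c d) (g : hom b c) (f : hom a b),
    comp h (comp g f) = comp (comp h g) f }.
Arguments hom {_} _ _.
Arguments idm {_} _.
Arguments comp {_ _ _ _} _ _.

Record cfunctor (C D : category) := CFunctor {
  fob :> C -> D;
  fmor : forall a b, hom a b -> hom (fob a) (fob b);
  fmor1 : forall a, fmor (idm a) = idm (fob a);
  fmorM : forall a b c (g : hom b c) (f : hom a b),
    fmor (comp g f) = comp (fmor g) (fmor f) }.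
Arguments fmor {C D} _ {a b} _.

Definition idfunctor (C : category) : cfunctor C C :=
  @CFunctor C C id (fun _ _ f => f) (fun=> erefl) (fun _ _ _ _ _ => erefl).

Section Power.
Variables (m : nat) (C : category).

Definition pow_hom (S T : 'I_m -> C) : choiceType :=
  {dffun forall i, hom (S i) (T i)}.
Definition pow_id (S : 'I_m -> C) : pow_hom S S := [ffun i => idm (S i)].
Definition pow_comp (S T U : 'I_m -> C) (g : pow_hom T U) (f : pow_hom S T) :
  pow_hom S U := [ffun i => comp (g i) (f i)].

Fact pow_comp1m S T (f : pow_hom S T) : pow_comp (pow_id T) f = f.
Proof. by apply/ffunP => i; rewrite !ffunE comp1m. Qed.
Fact pow_compm1 S T (f : pow_hom S T) : pow_comp f (pow_id S) = f.
Proof. by apply/ffunP => i; rewrite !ffunE compm1. Qed.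
Fact pow_compA S T U V (h : pow_hom U V) (g : pow_hom T U) (f : pow_hom S T) :
  pow_comp h (pow_comp g f) = pow_comp (pow_comp h g) f.
Proof. by apply/ffunP => i; rewrite !ffunE compmA. Qed.

Definition power : category := Category pow_comp1m pow_compm1 pow_compA.

Variable F : 'I_m -> cfunctor C C.

Definition prod_mor (S T : power) (f : hom S T) :
    @hom power (fun j => F j (S j)) (fun j => F j (T j)) :=
  [ffun j => fmor (F j) (f j)].
Fact prod_mor1 (S : power) : prod_mor (idm S) = idm (_ : power).
Proof. by apply/ffunP => j; rewrite !ffunE fmor1. Qed.
Fact prod_morM (S T U : power) (g : hom T U) (f : hom S T) :
  prod_mor (comp g f) = comp (prod_mor g) (prod_mor f).
Proof. by apply/ffunP => j; rewrite !ffunE fmorM. Qed.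

Definition prod_functor : cfunctor power power := CFunctor prod_mor1 prod_morM.
End Power.

Definition at_component m (C : category) (F : cfunctor C C) (i : 'I_m) :
    cfunctor (power m C) (power m C) :=
  prod_functor (fun j => if j == i then F else idfunctor C).

Section Modules.
Variable k : fieldType.

Record cmod (C : category) := CMod {
  mob :> C -> lmodType k;
  act : forall a b, hom a b -> {linear mob a -> mob b};
  act1 : forall a x, act (idm a) x = x;
  actM : forall a b c (g : hom b c) (f : hom a b) x,
    act (comp g f) x = act g (act f x) }.
Arguments act {C} _ {a b} _.

Record mhom (C : category) (V W : cmod C) := MHom {
  mcomp :> forall a, {linear V a -> W a};
  mhom_nat : forall a b (f : hom a b) x,
    mcomp b (act V f x) = act W f (mcomp a x) }.

Lemma mhom_ext C (V W : cmod C) (f g : mhom V W) :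
  (forall a, f a =1 g a) -> f = g.
Proof.
case: f g => f fN [g gN] /= fg.
have {}fg : f = g.
  by apply: functional_extensionality_dep => a; apply: linear_ext; apply: fg.
by subst g; congr MHom; apply: Prop_irrelevance.
Qed.

Definition mhom_comp C (U V W : cmod C) (g : mhom V W) (f : mhom U V) :
  mhom U W.
Proof.
by exists (fun a => g a \o f a) => a b h x /=; rewrite !mhom_nat.
Defined.

Definition mod_iso C (V W : cmod C) : Prop :=
  exists (f : mhom V W) (g : mhom W V),
    (forall a, cancel (f a) (g a)) /\ (forall a, cancel (g a) (f a)).

Section HomSpace.
Variables (C : category) (V W : cmod C).
Implicit Types f g h : mhom V W.

Definition mhom0 : mhom V W.
Proof. by exists (fun a => \0) => a b h x /=; rewrite linear0. Defined.
Definition mhom_opp f : mhom V W.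
Proof.
by exists (fun a => \- f a) => a b h x /=; rewrite mhom_nat linearN.
Defined.
Definition mhom_add f g : mhom V W.
Proof.
by exists (fun a => f a \+ g a) => a b h x /=; rewrite !mhom_nat linearD.
Defined.
Definition mhom_scale (c : k) f : mhom V W.
Proof.
by exists (fun a => c \*: f a) => a b h x /=; rewrite mhom_nat linearZ.
Defined.

HB.instance Definition _ := gen_eqMixin (mhom V W).
HB.instance Definition _ := gen_choiceMixin (mhom V W).

Fact mhom_addA : associative mhom_add.
Proof. by move=> f g h; apply: mhom_ext => a x /=; rewrite addrA. Qed.
Fact mhom_addC : commutative mhom_add.
Proof. by move=> f g; apply: mhom_ext => a x /=; rewrite addrC. Qed.
Fact mhom_add0 : left_id mhom0 mhom_add.
Proof. by move=> f; apply: mhom_ext => a x /=; rewrite add0r. Qed.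
Fact mhom_addN : left_inverse mhom0 mhom_opp mhom_add.
Proof. by move=> f; apply: mhom_ext => a x /=; rewrite addNr. Qed.
HB.instance Definition _ := GRing.isZmodule.Build (mhom V W)
  mhom_addA mhom_addC mhom_add0 mhom_addN.

Fact mhom_scaleA c d f : mhom_scale c (mhom_scale d f) = mhom_scale (c * d) f.
Proof. by apply: mhom_ext => a x /=; rewrite scalerA. Qed.
Fact mhom_scale1 : left_id 1 mhom_scale.
Proof. by move=> f; apply: mhom_ext => a x /=; rewrite scale1r. Qed.
Fact mhom_scaleDr : right_distributive mhom_scale +%R.
Proof. by move=> c f g; apply: mhom_ext => a x /=; rewrite scalerDr. Qed.
Fact mhom_scaleDl f : {morph mhom_scale^~ f : c d / c + d}.
Proof. by move=> c d; apply: mhom_ext => a x /=; rewrite scalerDl. Qed.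
HB.instance Definition _ := GRing.Zmodule_isLmodule.Build k (mhom V W)
  mhom_scaleA mhom_scale1 mhom_scaleDr mhom_scaleDl.
End HomSpace.

Section Principal.
Variables (C : category).

(* The module usually written [M(S)]. *)
Definition principal (S : C) : cmod C.
Proof.
refine (@CMod C (fun T => {malg k[hom S T]})
  (fun T U f => lin_map (fun h : hom S T => comp f h)) _ _).
- move=> T; apply: (free_ext (g := idfun)) => h /=.
  by rewrite lin_mapU comp1m.
- move=> T U X g f.
  apply: (free_ext (g := lin_map (comp g) \o lin_map (comp f))) => h /=.
  by rewrite !lin_mapU compmA.
Defined.

(* The map [M(T) -> M(S)] induced by [r : S -> T], namely [g |-> g r]. *)
Definition principal_map (S T : C) (r : hom S T) :
  mhom (principal T) (principal S).
Proof.
exists (fun U => lin_map (fun g => comp g r)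
  : {linear {malg k[hom T U]} -> {malg k[hom S U]}}) => U X f /=.
apply: (free_ext (f := lin_map _ \o lin_map _) (g := lin_map _ \o lin_map _)).
by move=> h /=; rewrite !lin_mapU compmA.
Defined.
End Principal.

Section Shift.
Variables (C : category) (F : cfunctor C C).

Definition shift (V : cmod C) : cmod C.
Proof.
refine (@CMod C (fun S => V (F S)) (fun S T f => act V (fmor F f)) _ _).
- by move=> S x; rewrite fmor1 act1.
- by move=> S T U g f x; rewrite fmorM actM.
Defined.

Definition shift_map (V W : cmod C) (f : mhom V W) : mhom (shift V) (shift W).
Proof. by exists (fun S => f (F S)) => S T g x /=; rewrite mhom_nat. Defined.

(* [r : S -> T] acts on [al : Hom(shift M(S), V)] by precomposition with
   [shift M(T) -> shift M(S)], [g |-> g r]. *)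
Definition coind_act (V : cmod C) (S T : C) (r : hom S T)
    (al : mhom (shift (principal S)) V) : mhom (shift (principal T)) V :=
  mhom_comp al (shift_map (principal_map r)).

Lemma coind_act_is_linear V S T (r : hom S T) : linear (@coind_act V S T r).
Proof. by move=> c f g; apply: mhom_ext => a x. Qed.
HB.instance Definition _ V S T (r : hom S T) :=
  GRing.isLinear.Build k (mhom (shift (principal S)) V)
    (mhom (shift (principal T)) V) _ (@coind_act V S T r)
    (coind_act_is_linear r).

Definition coinduction (V : cmod C) : cmod C.
Proof.
refine (@CMod C (fun S => mhom (shift (principal S)) V)
  (fun S T r => @coind_act V S T r) _ _).
- move=> S al; apply: mhom_ext => U; apply: free_ext => h /=.
  by rewrite lin_mapU compm1.
- move=> S T U g f al; apply: mhom_ext => X.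
  apply: free_ext => h /=.
  by rewrite !lin_mapU compmA.
Defined.
End Shift.

Definition external_tensor m (C : category) (V : 'I_m -> cmod C) :
  cmod (power m C).
Proof.
refine (@CMod (power m C) (fun S => tensor (fun j => V j (S j)))
  (fun S T f => tensor_map (fun j => act (V j) (f j))) _ _).
- by move=> S; apply: tensor_map_id => j x; rewrite ffunE act1.
- by move=> S T U g f; apply: tensor_map_comp => j x; rewrite ffunE actM.
Defined.

End Modules.
Arguments act {k C} _ {a b} _.

(* The carriers are in [Set]: the objects then form a small enough type for the
   spaces of natural transformations to be [lmodType]s, which is not so with
   [finType] for the type of objects. *)
Record finite_set := FiniteSet {
  carrier : Set;
  finite_class : Finite.axioms_ carrier }.

Definition finite_set_finType (S : finite_set) : finType :=
  Finite.Pack (finite_class S).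
Coercion finite_set_finType : finite_set >-> finType.

Definition injection (S T : finite_set) : choiceType :=
  {f : {ffun S -> T} | injectiveb f}.

Definition Injection (S T : finite_set) (f : S -> T) (f_inj : injective f) :
  injection S T.
Proof.
exists [ffun x => f x]; apply/injectiveP => x y; rewrite !ffunE; exact: f_inj.
Defined.

Lemma injection_inj S T (f : injection S T) : injective (val f).
Proof. exact/injectiveP/(valP f). Qed.
Arguments injection_inj {S T} f.

Definition FI_id (S : finite_set) : injection S S := Injection (@inj_id S).

Definition FI_comp (S T U : finite_set) (g : injection T U) (f : injection S T) :
  injection S U := Injection (inj_comp (injection_inj g) (injection_inj f)).

Fact FI_comp1m S T (f : injection S T) : FI_comp (FI_id T) f = f.
Proof. by apply/val_inj/ffunP => x; do ?rewrite !ffunE /=. Qed.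
Fact FI_compm1 S T (f : injection S T) : FI_comp f (FI_id S) = f.
Proof. by apply/val_inj/ffunP => x; do ?rewrite !ffunE /=. Qed.
Fact FI_compA S T U X (h : injection U X) (g : injection T U)
    (f : injection S T) :
  FI_comp h (FI_comp g f) = FI_comp (FI_comp h g) f.
Proof. by apply/val_inj/ffunP => x; do ?rewrite !ffunE /=. Qed.

Definition FI : category := Category FI_comp1m FI_compm1 FI_compA.

(* The added point is [None : option S]. *)
Definition add_point (S : finite_set) : finite_set :=
  @FiniteSet (option (carrier S))
    (Finite.class (option (S : finType) : finType)).

Definition iota_mor (S T : FI) (f : hom S T) :
  @hom FI (add_point S) (add_point T) :=
  @Injection (add_point S) (add_point T) (omap (val f))
    (inj_omap (injection_inj f)).

Fact iota_mor1 (S : FI) : iota_mor (idm S) = @idm FI (add_point S).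
Proof. by apply/val_inj/ffunP => -[x|]; do ?rewrite !ffunE /=. Qed.
Fact iota_morM (S T U : FI) (g : hom T U) (f : hom S T) :
  iota_mor (comp g f) = comp (iota_mor g) (iota_mor f).
Proof.
by apply/val_inj/ffunP => -[x|]; do ?rewrite !ffunE /=.
Qed.

Definition hat : cfunctor FI FI :=
  @CFunctor FI FI add_point iota_mor iota_mor1 iota_morM.

Section Coinduction.
Variable k : fieldType.

Definition Q : cmod k FI -> cmod k FI := coinduction hat.

Definition Qi m (i : 'I_m) : cmod k (power m FI) -> cmod k (power m FI) :=
  coinduction (at_component hat i).
End Coinduction.

(* Main.v *)
From HB Require Import structures.
Require Import Defs.
From mathcomp Require Import all_boot all_algebra.
From mathcomp Require Import boolp monalg.
Local Open Scope ring_scope.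

(** An injection [h : S -> T + {*}] either avoids [*], and is then an injection
    [S -> T], or hits it at a single [s], and is then an injection
    [S \ {s} -> T].  So there are finitely many universal injections
    [e_o : S -> X_o + {*}], indexed by [o : option S], through exactly one of
    which every [h] factors, and it does so uniquely.  Hence [Sigma M(S)] is
    the direct sum of the [M(X_o)], and a homomorphism out of it is a free
    choice of its values at the finitely many [e_o]:
    [Q(V)(S) = V(S) + sum_(s in S) V(S \ {s})].
    Tensor products commute with finite direct sums, which gives the theorem
    degree by degree; one map, natural in [S], realises all these
    isomorphisms.

    This argument uses only the finite universal family ([multi_adjoint]
    below), and the identity functor has one too, with a single member.
    Since coinduction along the identity changes nothing ([coinduction_id],
    the Yoneda lemma), the theorem is the case [F_i = hat], [F_j = id] for
    [j <> i], of a statement symmetric in the factors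
    ([coinduction_external_tensor]): coinduction along [F_1 x ... x F_m] of
    an external tensor product is the external tensor product of the
    coinductions along the [F_j].

    The comparison map [coind_tensor] sends a tensor of homomorphisms
    [al_j] to the homomorphism [<< (h_j) >> |-> (x)_j al_j << h_j >>].
    To invert it in degree [S], let [block x], for [x : V (X_o)], be the
    homomorphism with value [x] at [e_o] and [0] at the other members of the
    family.  Each homomorphism is the sum of its blocks ([coind_sum_block]),
    and tensors of blocks span the tensor product, so that every [t] is
    recovered from the values of its image at the universal family
    ([tensor_sum_block]); the same formula applied to arbitrary values gives
    surjectivity. *)

Set Implicit Arguments.
Unset Strict Implicit.
Unset Printing Implicit Defensive.
Import GRing.Theory.
Import Defs.

(** * Spanning sets of tensor products *)

Section TensorSpan.
Variables (k : fieldType) (I : finType) (W : I -> lmodType k).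

(** Pure tensors of elements of spanning sets [G j] generate [tensor W].
    Stated as an induction principle, it is proved by decomposing one
    coordinate at a time, which avoids the expansion of a product of sums over
    dependent choice functions. *)
Lemma tensor_ind (G : forall j, W j -> Prop) (P : tensor W -> Prop) :
  (forall j x, exists (O : finType) (y : O -> W j),
     (forall o, G j (y o)) /\ x = \sum_o y o) ->
  P 0 -> (forall a s t, P s -> P t -> P (a *: s + t)) ->
  (forall v, (forall j, G j (v j)) -> P (pure v)) ->
  forall t, P t.
Proof.
move=> Gspan P0 Plin PG.
have Psum (O : Type) (r : seq O) (c : O -> k) (F : O -> tensor W) :
    (forall o, P (F o)) -> P (\sum_(o <- r) c o *: F o).
  move=> PF; elim: r => [|o r IH]; first by rewrite big_nil.
  by rewrite big_cons; apply: Plin.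
(* [s] lists the coordinates still allowed to lie outside the spanning set. *)
have Ppure (s : seq I) v : (forall j, j \notin s -> G j (v j)) -> P (pure v).
  elim: s v => [|j s IH] v Gv; first by apply: PG => j; apply: Gv.
  have [O [y [Gy vj]]] := Gspan j (v j).
  have -> : v = dfwith v (\sum_o 1 *: y o).
    apply: functional_extensionality_dep => l.
    case: dfwithP => //; rewrite vj; apply: eq_bigr => o _.
    by rewrite scale1r.
  pose f : {linear W j -> tensor W} := HB.pack (fun x : W j => pure (dfwith v x))
    (GRing.isLinear.Build k (W j) (tensor W) _ _ (@pure_multilinear k I W v j)).
  rewrite (_ : pure _ = f (\sum_o 1 *: y o)) // linear_sum.
  under eq_bigr do rewrite linearZ.
  apply: Psum => o; apply: IH => l ls.
  have [lj|nlj] := eqVneq j l; first by subst l; rewrite dfwith_in.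
  by rewrite dfwith_out //; apply: Gv; rewrite inE negb_or eq_sym nlj.
move=> t; rewrite -(treprK t) (monalgE (trepr t)) linear_sum /=.
rewrite (_ : \sum_(i <- _) _ =
  \sum_(x <- finmap.enum_fset (msupp (trepr t))) (trepr t)@_x *: pure x).
  apply: Psum => v; apply: (Ppure (enum I)) => j.
  by rewrite mem_enum.
apply: eq_bigr => x _; rewrite /pure -linearZ /=; congr (tpi _).
by apply/malgP => y; rewrite mcoeffZ !mcoeffU mulrnAr mulr1.
Qed.

(** The coefficient [-1] in the multilinearity relation gives
    [pure v = - pure v + pure v]. *)
Lemma pure0 (v : forall j, W j) (j : I) : v j = 0 -> pure v = 0.
Proof.
move=> vj0; have := pure_multilinear v (-1 : k) (0 : W j) 0.
have -> : dfwith v (-1 *: 0 + 0 : W j) = v.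
  by apply: functional_extensionality_dep => l; case: dfwithP => //;
    rewrite vj0 scaler0 addr0.
have -> : dfwith v (0 : W j) = v.
  by apply: functional_extensionality_dep => l; case: dfwithP.
by rewrite scaleN1r addNr.
Qed.
End TensorSpan.

(** * Isomorphisms of modules *)

Section ModuleIsomorphisms.
Variables (k : fieldType) (C : category).
Implicit Types U V W : cmod k C.

Lemma mod_iso_refl V : mod_iso V V.
Proof.
have N a b (f : hom a b) x : idfun (act V f x) = act V f (idfun x) by [].
pose i : mhom V V := MHom (mcomp := fun a => idfun) N.
by exists i, i; split.
Qed.

Lemma mod_iso_sym V W : mod_iso V W -> mod_iso W V.
Proof. by move=> [f [g [fK gK]]]; exists g, f. Qed.

Lemma mod_iso_trans V U W : mod_iso U V -> mod_iso V W -> mod_iso U W.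
Proof.
move=> [f [f' [fK f'K]]] [g [g' [gK g'K]]].
exists (mhom_comp g f), (mhom_comp f' g'); split=> a x /=.
  by rewrite gK fK.
by rewrite f'K g'K.
Qed.

(** The pointwise inverse of a bijective homomorphism is automatically linear
    and natural. *)
Lemma mod_iso_inj_surj V W (f : mhom V W) :
  (forall a, injective (f a)) -> (forall a y, exists x, f a x = y) ->
  mod_iso V W.
Proof.
move=> f_inj f_surj.
pose g a y := projT1 (cid (f_surj a y)).
have gK a : cancel (g a) (f a) by move=> y; rewrite /g; case: cid.
have g_lin a : linear (g a).
  by move=> c x y; apply: (@f_inj a); rewrite gK linearP /= !gK.
pose G a : {linear W a -> V a} := HB.pack (g a)
  (GRing.isLinear.Build k (W a) (V a) _ _ (g_lin a)).
have GN a b (h : hom a b) x : G b (act W h x) = act V h (G a x).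
  by apply: (@f_inj b); rewrite mhom_nat /= !gK.
exists f, (MHom GN); split=> a x; last exact: gK.
by apply: (@f_inj a); rewrite /= gK.
Qed.

End ModuleIsomorphisms.

Section ExternalTensor.
Variables (k : fieldType) (m : nat) (C : category).
Implicit Types V W : 'I_m -> cmod k C.

Definition external_tensor_map V W (h : forall j, mhom (V j) (W j)) :
  mhom (external_tensor V) (external_tensor W).
Proof.
exists (fun S => tensor_map (fun j => h j (S j))
  : {linear external_tensor V S -> external_tensor W S}).
move=> S T r t.
rewrite /= -(tensor_map_comp (h := fun j => h j (T j) \o act (V j) (r j))) //.
rewrite -(tensor_map_comp (h := fun j => h j (T j) \o act (V j) (r j))) //.
by move=> j x /=; rewrite mhom_nat.
Defined.

Lemma external_tensor_iso V W :
  (forall j, mod_iso (V j) (W j)) ->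
  mod_iso (external_tensor V) (external_tensor W).
Proof.
move=> VW; pose f j := projT1 (cid (VW j)).
pose g j := projT1 (cid (projT2 (cid (VW j)))).
have fgK j : (forall a, cancel (f j a) (g j a)) /\
             (forall a, cancel (g j a) (f j a)).
  exact: (projT2 (cid (projT2 (cid (VW j))))).
exists (external_tensor_map f), (external_tensor_map g).
split=> S t /=;
  rewrite -(tensor_map_comp (h := fun j => idfun)) ?tensor_map_id // => j x /=.
  by rewrite (fgK j).1.
by rewrite (fgK j).2.
Qed.
End ExternalTensor.

(** * Coinduced modules as natural families of values *)

Section Evaluation.
Variables (k : fieldType) (C : category) (F : cfunctor C C) (V : cmod k C).

Definition coind_ev (S T : C) (h : hom S (F T)) (al : coinduction F V S) : V T :=
  al T << h >>.

Lemma coind_ev_is_linear S T (h : hom S (F T)) : linear (coind_ev h).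
Proof. by []. Qed.
HB.instance Definition _ S T (h : hom S (F T)) :=
  GRing.isLinear.Build k (coinduction F V S) (V T) _ (coind_ev h)
    (coind_ev_is_linear h).

Lemma coind_evP (S : C) (al be : coinduction F V S) :
  (forall T (h : hom S (F T)), coind_ev h al = coind_ev h be) -> al = be.
Proof. by move=> E; apply: mhom_ext => T; apply: free_ext => h; apply: E. Qed.

Lemma coind_ev_comp (S T U : C) (g : hom T U) (h : hom S (F T)) al :
  coind_ev (comp (fmor F g) h) al = act V g (coind_ev h al).
Proof. by rewrite /coind_ev -mhom_nat /= lin_mapU. Qed.

Lemma coind_ev_act (S T U : C) (r : hom S T) (h : hom T (F U))
    (al : coinduction F V S) :
  coind_ev h (act (coinduction F V) r al) = coind_ev (comp h r) al.
Proof. by rewrite /coind_ev /= lin_mapU. Qed.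

(** By freeness of [{malg k[hom S (F T)]}], a homomorphism
    [shift (principal S) -> V] is a natural family of values on basis vectors. *)
Section Build.
Variables (S : C) (c : forall T, hom S (F T) -> V T).
Hypothesis c_nat : forall T U (g : hom T U) h,
  c (comp (fmor F g) h) = act V g (c h).

Definition coind_of : coinduction F V S.
Proof.
exists (fun T => lin_ext (@c T) : {linear {malg k[hom S (F T)]} -> V T}).
move=> T U g; apply: (free_ext (f := lin_ext (@c U) \o lin_map _)
  (g := act V g \o lin_ext (@c T))) => h /=.
by rewrite lin_mapU !lin_extU c_nat.
Defined.

Lemma coind_ofE T (h : hom S (F T)) : coind_ev h coind_of = c h.
Proof. exact: lin_extU. Qed.
End Build.

End Evaluation.

(** The Yoneda lemma: evaluation at the identity of [S] identifies
    [Hom(M(S), V)] with [V S]. *)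
Lemma coinduction_id (k : fieldType) (C : category) (V : cmod k C) :
  mod_iso (coinduction (idfunctor C) V) V.
Proof.
have N S T (r : hom S T) (al : coinduction (idfunctor C) V S) :
    coind_ev (idm T : hom T (idfunctor C T)) (act (coinduction (idfunctor C) V) r al) =
    act V r (coind_ev (idm S : hom S (idfunctor C S)) al).
  by rewrite coind_ev_act -coind_ev_comp /= comp1m compm1.
apply: (mod_iso_inj_surj (f := MHom (mcomp := fun S =>
  coind_ev (F := idfunctor C) (V := V) (idm S : hom S (idfunctor C S))) N)).
  move=> S al be /= E; apply: coind_evP => T h.
  have -> : h = comp (fmor (idfunctor C) h) (idm S) by rewrite /= compm1.
  by rewrite !coind_ev_comp E.
move=> S x; have c_nat T U (g : hom T U) (h : hom S T) :
  act V (comp g h) x = act V g (act V h x) by rewrite actM.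
exists (@coind_of k C (idfunctor C) V S (fun T h => act V h x) c_nat) => /=.
by rewrite coind_ofE act1.
Qed.

(** * Finite universal families *)

(** A finite family of arrows [e_o : S -> F X_o] through exactly one of which
    every arrow [S -> F T] factors, uniquely; equivalently,
    [hom S (F T)] is naturally the disjoint union over [o] of the
    [hom X_o T].  For a singleton index this is a universal arrow from [S] to
    [F], as for a left adjoint of [F].  Index and factor are packed
    in a single sigma type, so that uniqueness of both is one injectivity
    statement. *)
Record multi_adjoint (C : category) (F : cfunctor C C) (S : C) := MultiAdjoint {
  ma_index : finType;
  ma_ob : ma_index -> C;
  ma_unit : forall o, hom S (F (ma_ob o));
  ma_factor : forall T (h : hom S (F T)), exists p : {o & hom (ma_ob o) T},
    comp (fmor F (tagged p)) (ma_unit (tag p)) = h;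
  ma_factor_inj : forall T, injective
    (fun p : {o & hom (ma_ob o) T} => comp (fmor F (tagged p)) (ma_unit (tag p)))
}.

Section CoinductionBlocks.
Variables (k : fieldType) (C : category) (F : cfunctor C C) (V : cmod k C).
Variables (S : C) (A : multi_adjoint F S).
Notation X := (ma_ob (m := A)).
Notation e := (ma_unit (m := A)).

Definition factor T (h : hom S (F T)) : {o & hom (X o) T} :=
  projT1 (cid (ma_factor A h)).

Lemma factor_unit T o (g : hom (X o) T) :
  factor (comp (fmor F g) (e o)) = Tagged (fun o => hom (X o) T) g.
Proof.
by rewrite /factor; case: cid => p /= E; apply: (@ma_factor_inj _ _ _ A T).
Qed.

Lemma factorP T (h : hom S (F T)) :
  exists o (g : hom (X o) T), h = comp (fmor F g) (e o).
Proof. by case: (ma_factor A h) => -[o g] /= <-; exists o, g. Qed.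

Lemma coind_unit_ext (al be : coinduction F V S) :
  (forall o, coind_ev (e o) al = coind_ev (e o) be) -> al = be.
Proof.
move=> E; apply: coind_evP => T h; have [o [g ->]] := factorP h.
by rewrite !coind_ev_comp E.
Qed.

(** The values on basis vectors of the homomorphism that sends [e o] to [x] and
    the other members of the family to [0].  Letting [dfwith] choose between
    [x] and [0] keeps the value in [V (X (tag (factor h)))] without any
    transport along an equality of indices. *)
Definition block_value o (x : V (X o)) T (h : hom S (F T)) : V T :=
  act V (tagged (factor h)) (dfwith (fun o => 0 : V (X o)) x (tag (factor h))).

Fact block_value_nat o (x : V (X o)) T U (g : hom T U) (h : hom S (F T)) :
  block_value x (comp (fmor F g) h) = act V g (block_value x h).
Proof.
have [o' [g' ->]] := factorP h.
by rewrite /block_value compmA -fmorM !factor_unit /= actM.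
Qed.

Definition block o (x : V (X o)) : coinduction F V S :=
  coind_of (block_value_nat x).

Lemma block_unit o (x : V (X o)) o' :
  coind_ev (e o') (block x) = dfwith (fun o => 0 : V (X o)) x o'.
Proof.
rewrite coind_ofE /block_value.
have -> : factor (e o') = Tagged (fun o => hom (X o) (X o')) (idm (X o')).
  by rewrite -factor_unit fmor1 comp1m.
by rewrite /= act1.
Qed.

Lemma block_unit_eq o (x : V (X o)) : coind_ev (e o) (block x) = x.
Proof. by rewrite block_unit dfwith_in. Qed.

Lemma block_unit_neq o (x : V (X o)) o' :
  o != o' -> coind_ev (e o') (block x) = 0.
Proof. by move=> oo'; rewrite block_unit dfwith_out. Qed.

Lemma block_is_linear o : linear (@block o).
Proof.
move=> a x y; apply: coind_unit_ext => o'; rewrite linearP /=.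
have [oo'|oo'] := eqVneq o o'.
  by subst o'; rewrite !block_unit_eq.
by rewrite !block_unit_neq // scaler0 addr0.
Qed.
HB.instance Definition _ o :=
  GRing.isLinear.Build k (V (X o)) (coinduction F V S) _ (@block o)
    (@block_is_linear o).

(** The decomposition of [coinduction F V S] as the direct sum of the
    [V (X o)]. *)
Lemma coind_sum_block (al : coinduction F V S) :
  al = \sum_o block (coind_ev (e o) al).
Proof.
apply: coind_unit_ext => o; rewrite linear_sum (bigD1 o) //= block_unit_eq.
by rewrite big1 ?addr0 // => o' o'o; rewrite block_unit_neq.
Qed.

End CoinductionBlocks.

(** A universal family for a product functor consists of the tuples of members
    of the families of its factors. *)
Section ProductMultiAdjoint.
Variables (m : nat) (C : category) (F : 'I_m -> cfunctor C C) (S : power m C).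
Variable A : forall j, multi_adjoint (F j) (S j).

Definition prod_index : finType := {dffun forall j, ma_index (A j)}.
Definition prod_ob (o : prod_index) : power m C := fun j => ma_ob (o j).
Definition prod_unit (o : prod_index) : hom S (prod_functor F (prod_ob o)) :=
  [ffun j => ma_unit (o j)].

Fact prod_factor T (h : hom S (prod_functor F T)) :
  exists p : {o & hom (prod_ob o) T},
    comp (fmor (prod_functor F) (tagged p)) (prod_unit (tag p)) = h.
Proof.
pose p j := factor (A j) (h j).
pose o : prod_index := [ffun j => tag (p j)].
have E j : exists g : hom (ma_ob (o j)) (T j),
    comp (fmor (F j) g) (ma_unit (o j)) = h j.
  rewrite /o ffunE; exists (tagged (p j)).
  by rewrite /p /factor; case: cid.
have [g gE] : exists g : hom (prod_ob o) T,
    forall j, comp (fmor (F j) (g j)) (ma_unit (o j)) = h j.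
  exists [ffun j => projT1 (cid (E j))] => j; rewrite ffunE.
  exact: (projT2 (cid (E j))).
exists (Tagged (fun o => hom (prod_ob o) T) g).
by apply/ffunP => j; rewrite !ffunE; apply: gE.
Qed.

Fact prod_factor_inj T : injective (fun p : {o & hom (prod_ob o) T} =>
  comp (fmor (prod_functor F) (tagged p)) (prod_unit (tag p))).
Proof.
move=> [o g] [o' g'] /ffunP /= E.
have {}E j : Tagged (fun a => hom (ma_ob a) (T j)) (g j) =
             Tagged (fun a => hom (ma_ob a) (T j)) (g' j).
  by apply: (@ma_factor_inj _ _ _ (A j) (T j)); move: (E j); rewrite !ffunE.
have oo' : o = o'.
  by apply/ffunP => j; exact: (congr1 (@tag _ _) (E j)).
subst o'; congr (Tagged _ _); apply/ffunP => j.
exact: (eq_from_Tagged (E j)).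
Qed.

Definition prod_multi_adjoint : multi_adjoint (prod_functor F) S :=
  MultiAdjoint prod_factor prod_factor_inj.
End ProductMultiAdjoint.

(** * Coinduction of external tensor products *)

Section CoinductionTensor.
Variables (k : fieldType) (m : nat) (C : category).
Variables (F : 'I_m -> cfunctor C C) (V : 'I_m -> cmod k C).
Notation QV := (fun j => coinduction (F j) (V j)).
Notation PF := (prod_functor F).

Section Component.
Variable S : power m C.

(** The tensor product of the evaluations at the [h j]: the value at [h] of the
    homomorphism that corresponds to a tensor of homomorphisms.  Defining the
    comparison map through [tensor_map] reduces its naturality to
    functoriality of tensor products. *)
Definition tensor_ev T (h : hom S (PF T)) :
    {linear external_tensor QV S -> external_tensor V T} :=
  tensor_map (fun j => coind_ev (F := F j) (V := V j) (h j)).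

Fact tensor_ev_nat (t : external_tensor QV S) T U (g : hom T U)
    (h : hom S (PF T)) :
  tensor_ev (comp (fmor PF g) h) t = act (external_tensor V) g (tensor_ev h t).
Proof.
rewrite /tensor_ev /=; apply: tensor_map_comp => j x /=.
by rewrite !ffunE coind_ev_comp.
Qed.

Definition coind_tensor (t : external_tensor QV S) :
    coinduction PF (external_tensor V) S :=
  coind_of (tensor_ev_nat t).

Lemma coind_tensorE t T (h : hom S (PF T)) :
  coind_ev h (coind_tensor t) = tensor_ev h t.
Proof. exact: coind_ofE. Qed.

Lemma coind_tensor_is_linear : linear coind_tensor.
Proof.
move=> a s t; apply: coind_evP => T h.
by rewrite coind_tensorE linearP -!(coind_tensorE _ h).
Qed.
HB.instance Definition _ :=
  GRing.isLinear.Build k (external_tensor QV S)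
    (coinduction PF (external_tensor V) S) _ coind_tensor
    coind_tensor_is_linear.

End Component.

Lemma coind_tensor_nat S T (r : hom S T) (t : external_tensor QV S) :
  coind_tensor (act (external_tensor QV) r t) =
  act (coinduction PF (external_tensor V)) r (coind_tensor t).
Proof.
apply: coind_evP => U h; rewrite coind_ev_act !coind_tensorE /tensor_ev /=.
apply/esym; apply: tensor_map_comp => j x /=.
by rewrite ffunE coind_ev_act.
Qed.

Definition coind_tensor_hom :
    mhom (external_tensor QV) (coinduction PF (external_tensor V)) :=
  MHom (mcomp := fun S => @coind_tensor S) coind_tensor_nat.

Section Bijectivity.
Variables (S : power m C) (A : forall j, multi_adjoint (F j) (S j)).
Notation PA := (prod_multi_adjoint A).

Definition tensor_block (o : ma_index PA) :
    {linear external_tensor V (ma_ob o) -> external_tensor QV S} :=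
  tensor_map (fun j => block (V := V j) (A := A j) (o := o j)).

Lemma tensor_block_eq o (t : external_tensor V (ma_ob o)) :
  tensor_ev (ma_unit o) (tensor_block o t) = t.
Proof.
rewrite -[RHS](tensor_map_id (f := fun j => idfun)) //.
apply/esym; apply: tensor_map_comp => j x /=.
by rewrite ffunE block_unit_eq.
Qed.

(** Some coordinate of [o'] differs from that of [o], and there evaluation of a
    block gives [0]. *)
Lemma tensor_block_neq o o' (t : external_tensor V (ma_ob o)) :
  o != o' -> tensor_ev (ma_unit o') (tensor_block o t) = 0.
Proof.
move=> oo'; have [j oj] : exists j, o j != o' j.
  by apply/existsP; apply: contraNT oo' => /existsPn E; apply/eqP/ffunP => j;
    apply/eqP; move: (E j); rewrite negbK.
apply: (tensor_ext (f := tensor_ev (ma_unit o') \o tensor_block o)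
  (g := \0)) => v /=.
rewrite !tensor_map_pure; apply: (pure0 (j := j)).
by rewrite /= ffunE block_unit_neq.
Qed.

(** Both sides are linear in [t], so that a tensor of blocks may be assumed, for
    which only the summand of its own index survives.  As the right-hand side
    depends on [t] only through its image under [coind_tensor], this gives
    injectivity. *)
Lemma tensor_sum_block (t : external_tensor QV S) :
  t = \sum_o tensor_block o (tensor_ev (ma_unit o) t).
Proof.
pose G j (al : QV j (S j)) := exists o (x : V j (ma_ob o)),
  al = block (A := A j) x.
pose P s := s = \sum_o tensor_block o (tensor_ev (ma_unit o) s).
apply: (tensor_ind (G := G) (P := P)) => [j al||a s s' sE s'E|v Gv]; rewrite /P.
- exists (ma_index (A j)), (fun o => block (coind_ev (ma_unit o) al)).
  by split=> [o|]; [exists o, (coind_ev (ma_unit o) al)|exact: coind_sum_block].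
- by rewrite big1 // => o _; rewrite !linear0.
- rewrite {1}sE {1}s'E scaler_sumr -big_split; apply: eq_bigr => o _.
  by rewrite !linearP.
have [o oE] : exists o : ma_index PA,
    forall j, exists x : V j (ma_ob (o j)), v j = block x.
  exists [ffun j => projT1 (cid (Gv j))] => j; rewrite ffunE.
  exact: (projT2 (cid (Gv j))).
pose x j := projT1 (cid (oE j)).
have -> : pure v = tensor_block o (pure x).
  rewrite /tensor_block /= tensor_map_pure; congr pure.
  by apply: functional_extensionality_dep => j; exact: (projT2 (cid (oE j))).
rewrite (bigD1 o) //= tensor_block_eq big1 ?addr0 // => o' o'o.
by rewrite tensor_block_neq ?linear0 // eq_sym.
Qed.

Lemma coind_tensor_inj : injective (@coind_tensor S).
Proof.
move=> s t st; rewrite (tensor_sum_block s) (tensor_sum_block t).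
by apply: eq_bigr => o _; rewrite -!coind_tensorE st.
Qed.

Lemma coind_tensor_surj (be : coinduction PF (external_tensor V) S) :
  exists t, coind_tensor t = be.
Proof.
exists (\sum_(o : ma_index PA) tensor_block o (coind_ev (ma_unit o) be)).
apply: (coind_unit_ext (A := PA)) => o.
rewrite coind_tensorE linear_sum (bigD1 o) //= tensor_block_eq.
by rewrite big1 ?addr0 // => o' o'o; rewrite tensor_block_neq.
Qed.
End Bijectivity.

Theorem coinduction_external_tensor
    (A : forall j (X : C), multi_adjoint (F j) X) :
  mod_iso (coinduction PF (external_tensor V)) (external_tensor QV).
Proof.
apply/mod_iso_sym/(mod_iso_inj_surj (f := coind_tensor_hom)) => S.
  exact: (coind_tensor_inj (fun j => A j (S j))).
exact: (coind_tensor_surj (fun j => A j (S j))).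
Qed.
End CoinductionTensor.

(** * The universal families of the identity and of adding a point *)

Section IdMultiAdjoint.
Variables (C : category) (S : C).
Notation e := (fun _ : unit => idm S : hom S (idfunctor C S)).

Fact id_factor T (h : hom S (idfunctor C T)) :
  exists p : {_ : unit & hom S T},
    comp (fmor (idfunctor C) (tagged p)) (e (tag p)) = h.
Proof. by exists (Tagged (fun=> hom S T) (i := tt) h); rewrite /= compm1. Qed.

Fact id_factor_inj T : injective (fun p : {_ : unit & hom S T} =>
  comp (fmor (idfunctor C) (tagged p)) (e (tag p))).
Proof. by move=> [[] g] [[] g'] /=; rewrite !compm1 => ->. Qed.

Definition id_multi_adjoint : multi_adjoint (idfunctor C) S :=
  MultiAdjoint id_factor id_factor_inj.
End IdMultiAdjoint.

Section HatMultiAdjoint.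
Variable S : FI.

Definition remove_point (s : S) : FI :=
  @FiniteSet {x : carrier S | (x : S) != s}
    (Finite.class ({x : S | x != s} : finType)).

Definition hat_ob (o : option S) : FI := if o is Some s then remove_point s else S.

Lemma insub_point_inj (s : S) :
  injective (fun x : S => insub x : option {x : S | x != s}).
Proof.
move=> x y; case: insubP => [u _ ux|/negPn/eqP ->].
  by case: insubP => [u' _ u'y [uu']|//]; rewrite -ux -u'y uu'.
by case: insubP => [//|/negPn/eqP ->].
Qed.

(** The family consists of [Some : S -> option S] and, for each [s], of the
    injection that sends [s] to the added point: [insub] returns [None] exactly
    where the condition [x != s] fails. *)
Definition hat_unit (o : option S) : hom S (hat (hat_ob o)) :=
  match o with
  | None => @Injection S (add_point S) Some (@Some_inj _)
  | Some s => @Injection S (add_point (remove_point s)) _ (@insub_point_inj s)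
  end.

(** The preimage of the added point recovers the index, which is how the
    index of a factorization is both found and shown unique. *)
Lemma hat_unit_eq_None o (x : S) : (val (hat_unit o) x == None) = (o == Some x).
Proof.
case: o => [s|]; rewrite /= ffunE //.
case: insubP => [u us _|/negPn/eqP ->]; last by rewrite !eqxx.
by rewrite (inj_eq (@Some_inj _)) [s == x]eq_sym (negPf us).
Qed.

Lemma hat_unit_onto o (y : hat_ob o) : exists x, val (hat_unit o) x = Some y.
Proof.
case: o y => [s|] y /=; last by exists y; rewrite ffunE.
by exists (val y); rewrite ffunE valK.
Qed.

Lemma hat_unitE T o (g : @hom FI (hat_ob o) T) (x : S) :
  val (comp (fmor hat g) (hat_unit o)) x =
  omap (val g) (val (hat_unit o) x).
Proof. by do ?rewrite ffunE /=. Qed.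

Fact hat_factor T (h : hom S (hat T)) :
  exists p : {o & hom (hat_ob o) T},
    comp (fmor hat (tagged p)) (hat_unit (tag p)) = h.
Proof.
have [o oP] : exists o : option S,
    forall x, (val h x == None :> option T) = (o == Some x).
  have [s /eqP hs|hN] := pickP (fun s => val h s == None :> option T).
    exists (Some s) => x; rewrite (inj_eq (@Some_inj _)) -hs.
    by rewrite (inj_eq (injection_inj h)) eq_sym.
  by exists None => x; rewrite hN.
(* [h] maps to the added point only the element that [hat_unit o] does, so that
   it has a value in [T] at the unique preimage of each [y]. *)
have hsome (y : hat_ob o) : {z : T | forall x,
    val (hat_unit o) x = Some y -> val h x = Some z}.
  have [x xy] := cid (hat_unit_onto y).
  have : val h x != None :> option T by rewrite oP -hat_unit_eq_None xy.
  case hx : (val h x) => [z|//] _; exists z => x' x'y.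
  by rewrite (injection_inj (hat_unit o) _ _ (etrans x'y (esym xy))).
pose g y := projT1 (hsome y).
have gP y x : val (hat_unit o) x = Some y -> val h x = Some (g y).
  exact: (projT2 (hsome y)).
have g_inj : injective g.
  move=> y y' gy; have [x xy] := hat_unit_onto y.
  have [x' x'y'] := hat_unit_onto y'.
  have xx' : x = x'.
    by apply: (injection_inj h); rewrite (gP _ _ xy) (gP _ _ x'y') gy.
  by move: xy; rewrite xx' x'y' => -[].
exists (Tagged (fun o => hom (hat_ob o) T) (Injection g_inj : hom (hat_ob o) T)).
apply/val_inj/ffunP => x; rewrite hat_unitE /=.
case xy : (val (hat_unit o) x) => [y|] /=; first by rewrite ffunE (gP _ _ xy).
have /eqP hx : val h x == None :> option T by rewrite oP -hat_unit_eq_None xy.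
by rewrite hx.
Qed.

Fact hat_factor_inj T : injective (fun p : {o & hom (hat_ob o) T} =>
  comp (fmor hat (tagged p)) (hat_unit (tag p))).
Proof.
move=> [o g] [o' g'] /(congr1 val)/ffunP E.
have {}E x : omap (val g) (val (hat_unit o) x) =
             omap (val g') (val (hat_unit o') x).
  by rewrite -!hat_unitE; apply: E.
have oo' : o = o'.
  have S_o x : (o == Some x) = (o' == Some x).
    rewrite -!hat_unit_eq_None; move: (E x).
    by case: (val (hat_unit o) x) (val (hat_unit o') x) => [?|] [?|].
  case: o {E g} S_o => [s|] S_o; first by apply/esym/eqP; rewrite -S_o.
  by case: o' {g'} S_o => [s|//] /(_ s); rewrite eqxx.
subst o'; congr (Tagged _ _); apply/val_inj/ffunP => y.
by have [x xy] := hat_unit_onto y; move: (E x); rewrite xy => -[].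
Qed.

Definition hat_multi_adjoint : multi_adjoint hat S :=
  @MultiAdjoint FI hat S (option S : finType) hat_ob hat_unit hat_factor
    hat_factor_inj.
End HatMultiAdjoint.

Theorem theorem3p13 (k : fieldType) (char0 : [pchar k] =i pred0)
    (m : nat) (m_gt0 : (0 < m)%N) (V : 'I_m -> cmod k FI) (i : 'I_m) :
  mod_iso (Qi i (external_tensor V))
          (external_tensor (fun j => if j == i then Q (V j) else V j)).
Proof.
pose F j := if j == i then hat else idfunctor FI.
have A j X : multi_adjoint (F j) X.
  by rewrite /F; case: (j == i);
    [exact: hat_multi_adjoint|exact: id_multi_adjoint].
apply: mod_iso_trans (coinduction_external_tensor V A) _.
apply: external_tensor_iso => j; rewrite /F.
by case: (j == i); [exact: mod_iso_refl|exact: coinduction_id].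
Qed.
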